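(* Let $K$ be a field and $n\ge 3$. Consider the following bilinear products on $UT_n(K)$ (in each item, the products of pairs of basis elements that are not listed are zero): (1) $\mathbf{T}^1_{i,j}$ for $1<i\le n$, $1\le j<n$: $e_{i-1,i}*e_{j,j+1}=e_{1n}$; (2) $\mathbf{T}^2$: $e_{ik}*e_{kj}=e_{ij}$ for all $1\le i<k<j\le n$. If $n>3$, then the totally compatible structures on $UT_n(K)$ are exactly the $K$-linear combinations of the products (1) and (2). If $n=3$, then the totally compatible structures on $UT_n(K)$ are exactly the $K$-linear combinations of the products (1).
   Context: $K$ is an arbitrary field; all products are $K$-bilinear. $UT_n(K)$ is the associative algebra of strictly upper triangular $n\times n$ matrices over $K$ with the usual matrix product $\cdot$; it has the $K$-basis of matrix units $e_{ij}$ (also written $e_{i,j}$), $1\le i<j\le n$, with $e_{ij}\cdot e_{kl}=\delta_{jk}e_{il}$. A totally compatible structure on an associative algebra $(A,\cdot)$ is an associative bilinear product $*$ on the vector space $A$ such that $(a\cdot b)*c=(a*b)\cdot c=a\cdot(b*c)=a*(b\cdot c)$ for all $a,b,c\in A$. Linear combinations of products are taken in the vector space of bilinear maps $UT_n(K)\times UT_n(K)\to UT_n(K)$. *)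

(* Defs.v *)
From HB Require Import structures.
From mathcomp Require Import all_boot all_order all_algebra.

Set Implicit Arguments.
Unset Strict Implicit.
Unset Printing Implicit Defensive.

Import GRing.Theory.
Local Open Scope ring_scope.

Definition totally_compatible (K : fieldType) (A : lmodType K)
    (dot op : A -> A -> A) : Prop :=
  [/\ bilinear_for *:%R *:%R op, associative op &
      forall a b c : A,
        [/\ op (dot a b) c = dot (op a b) c,
            dot (op a b) c = dot a (op b c) &
            dot a (op b c) = op a (dot b c)]].

Section StrictlyUpperTriangular.
Variables (K : fieldType) (n : nat).

Definition sut : {pred 'M[K]_n} :=
  fun M => [forall i : 'I_n, forall j : 'I_n, (j <= i)%N ==> (M i j == 0)].

Lemma sutP (M : 'M[K]_n) :
  reflect (forall i j : 'I_n, (j <= i)%N -> M i j = 0) (M \in sut).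
Proof.
apply: (iffP forallP) => [h i j le_ji | h i].
  by have /forallP/(_ j)/implyP/(_ le_ji)/eqP := h i.
by apply/forallP => j; apply/implyP => le_ji; apply/eqP/h.
Qed.

Lemma sut_submod_closed : submod_closed sut.
Proof.
split=> [|c M N /sutP hM /sutP hN]; apply/sutP => i j le_ji; rewrite !mxE //.
by rewrite hM // hN // mulr0 addr0.
Qed.

HB.instance Definition _ :=
  GRing.isSubmodClosed.Build K 'M[K]_n sut sut_submod_closed.

Record UT : predArgType := MkUT { ut_mx :> 'M[K]_n; _ : ut_mx \in sut }.

HB.instance Definition _ := [isSub for ut_mx].
HB.instance Definition _ := [Choice of UT by <:].
HB.instance Definition _ := [SubChoice_isSubZmodule of UT by <:].
HB.instance Definition _ := [SubZmodule_isSubLmodule of UT by <:].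

Lemma sut_mul (a b : UT) : ut_mx a *m ut_mx b \in sut.
Proof.
have /sutP hM := valP a; have /sutP hN := valP b.
apply/sutP => i j le_ji /=.
rewrite mxE big1 // => k _; have [le_ki|lt_ik] := leqP k i.
  by rewrite hM ?mul0r.
by rewrite (hN k j) ?mulr0 // (leq_trans le_ji (ltnW lt_ik)).
Qed.

Definition ut_mul (a b : UT) : UT := MkUT (sut_mul a b).

Lemma ut_mulA : associative ut_mul.
Proof. by move=> a b c; apply: val_inj; rewrite /= mulmxA. Qed.

(* Rows and columns are numbered from 0, so [ut_e i j] is the matrix unit
   usually written e_{i+1,j+1}.  It is meaningful for i < j < n only; any other
   pair of indices gives 0. *)
Definition ut_e (i j : nat) : UT :=
  insubd 0 (\matrix_(p < n, q < n) ((p == i :> nat) && (q == j :> nat))%:R).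

Lemma ut_eE (i j : 'I_n) : (i < j)%N -> ut_e i j = delta_mx i j :> 'M[K]_n.
Proof.
move=> lt_ij; rewrite /ut_e; set M := \matrix_(_, _) _.
have -> : M = delta_mx i j by apply/matrixP => p q; rewrite !mxE.
rewrite insubdK //; apply/sutP => p q; rewrite mxE.
by case: eqP => //= ->; case: eqP => //= ->; rewrite leqNgt lt_ij.
Qed.

(* The bilinear product with table e_{ij} * e_{kl} = t i j k l, for i < j and
   k < l. *)
Definition product_of_table (t : nat -> nat -> nat -> nat -> UT) (a b : UT) :
    UT :=
  \sum_(i < n) \sum_(j < n | (i < j)%N) \sum_(k < n) \sum_(l < n | (k < l)%N)
    (ut_mx a i j * ut_mx b k l) *: t i j k l.

Lemma product_of_table_e t (i j k l : 'I_n) : (i < j)%N -> (k < l)%N ->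
  product_of_table t (ut_e i j) (ut_e k l) = t i j k l.
Proof.
move=> lt_ij lt_kl; rewrite /product_of_table !ut_eE //.
rewrite (bigD1 i) //= [X in _ + X]big1 ?addr0; last first.
  move=> p /negPf ne_pi; do 3!rewrite big1 // => ? _.
  by rewrite !mxE ne_pi mul0r scale0r.
rewrite (bigD1 j) //= [X in _ + X]big1 ?addr0; last first.
  move=> q /andP[_ /negPf ne_qj]; do 2!rewrite big1 // => ? _.
  by rewrite !mxE ne_qj andbF mul0r scale0r.
rewrite (bigD1 k) //= [X in _ + X]big1 ?addr0; last first.
  move=> p /negPf ne_pk; rewrite big1 // => ? _.
  by rewrite !mxE ne_pk mulr0 scale0r.
rewrite (bigD1 l) //= [X in _ + X]big1 ?addr0; last first.
  by move=> q /andP[_ /negPf ne_ql]; rewrite !mxE ne_ql andbF mulr0 scale0r.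
by rewrite !mxE !eqxx mulr1 scale1r.
Qed.

(* For 0 < i < n and 0 <= j < n - 1: e_{i-1,i} * e_{j,j+1} = e_{0,n-1}. *)
Definition T1 (i j : nat) : UT -> UT -> UT :=
  product_of_table (fun p q r s =>
    if [&& p == i.-1, q == i, r == j & s == j.+1] then ut_e 0 n.-1 else 0).

(* e_{ik} * e_{kj} = e_{ij}. *)
Definition T2 : UT -> UT -> UT :=
  product_of_table (fun p q r s => if q == r then ut_e p s else 0).

Definition T1_combination (c : 'I_n -> 'I_n -> K) (a b : UT) : UT :=
  \sum_(i < n | (0 < i)%N) \sum_(j < n | (j < n.-1)%N) c i j *: T1 i j a b.

End StrictlyUpperTriangular.

(* Main.v *)
From HB Require Import structures.
Require Import Defs.
From mathcomp Require Import all_boot all_order all_algebra.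

Import GRing.Theory.
Local Open Scope ring_scope.

Set Implicit Arguments.
Unset Strict Implicit.
Unset Printing Implicit Defensive.

(** Write [ab] for the matrix product, [a*b] for a totally compatible product,
    and number rows and columns from [0] to [m = n - 1].  The corner [e_{0m}]
    spans the two-sided annihilator of the matrix product, and both the row [b]
    and the column [q] of a matrix [M] can be read off [e_{0b} M] and
    [M e_{qm}], unless [b = 0] and [q = m] respectively.

    For [M = e_{ij} * e_{kl}], total compatibility gives
      [e_{0b} M = (e_{0b} e_{ij}) * e_{kl} = (e_{0b} * e_{ij}) e_{kl}
                = e_{0b} * (e_{ij} e_{kl})],
    and symmetrically on the right.  Hence outside the corner [M] is zero,
    except that for [j = k] it may have a nonzero entry at [(i, l)]
    ([op_entry_eq0]).  The same identities show that this entry depends neither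
    on [i] nor on [l], and then, by [(e_{0j} * e_{jl}) e_{lm} =
    e_{0j} (e_{jl} * e_{lm})], not on [j] either ([op_entry_weight],
    [weight_const]).  With [d] its constant value, [a*b] agrees with [d ab]
    modulo the corner ([op_entry]).

    At the corner, the difference [a*b - d ab] vanishes as soon as one factor is
    a non-simple matrix unit: that unit is a product, one of its two factors can
    be moved outside [*], and what remains is an entry away from the corner
    ([op_corner_l], [op_corner_r]).  So the difference is a combination of the
    products [T1 i j].

    Conversely such a combination takes its values in the annihilator and reads
    only the superdiagonals of its arguments.  It thus vanishes on products and,
    as the corner is not on the superdiagonal when [n >= 3], on its own values;
    adding it to [d ab] preserves all the identities
    ([null_perturbation_totally_compatible]).

    Finally [T2] is the matrix product itself ([T2E]); for [n = 3] its only
    nonzero product of matrix units is [e_{01} e_{12} = e_{02}], so that it is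
    one of the [T1 i j] ([ut_mul3_T1]). *)

Local Notation bilinear f := (bilinear_for *:%R *:%R f).

(** * Bilinear products and null perturbations *)

Section Bilinear.
Variables (K : fieldType) (A : lmodType K).
Implicit Types (f g dot op : A -> A -> A).

Section BilinearTheory.
Variables (f : A -> A -> A) (hf : bilinear f).

Lemma bilinear_Dl x y z : f (x + y) z = f x z + f y z.
Proof. by have := hf.1 z 1 x y; rewrite /= !scale1r. Qed.

Lemma bilinear_Dr x y z : f z (x + y) = f z x + f z y.
Proof. by have := hf.2 z 1 x y; rewrite /= !scale1r. Qed.

Lemma bilinear_0l y : f 0 y = 0.
Proof. by apply: (addrI (f 0 y)); rewrite -bilinear_Dl !addr0. Qed.

Lemma bilinear_0r x : f x 0 = 0.
Proof. by apply: (addrI (f x 0)); rewrite -bilinear_Dr !addr0. Qed.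

Lemma bilinear_Zl k x y : f (k *: x) y = k *: f x y.
Proof. by have := hf.1 y k x 0; rewrite /= bilinear_0l !addr0. Qed.

Lemma bilinear_Zr k x y : f x (k *: y) = k *: f x y.
Proof. by have := hf.2 x k y 0; rewrite /= bilinear_0r !addr0. Qed.

End BilinearTheory.

Lemma bilinear_add f g :
  bilinear f -> bilinear g -> bilinear (fun x y => f x y + g x y).
Proof.
move=> hf hg; split=> u k x y /=.
  by rewrite hf.1 hg.1 /= scalerDr addrACA.
by rewrite hf.2 hg.2 /= scalerDr addrACA.
Qed.

Lemma bilinear_scale d f : bilinear f -> bilinear (fun x y => d *: f x y).
Proof.
move=> hf; split=> u k x y /=.
  by rewrite hf.1 /= scalerDr !scalerA [d * k]mulrC.
by rewrite hf.2 /= scalerDr !scalerA [d * k]mulrC.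
Qed.

Lemma bilinear_sum (I : finType) (P : pred I) (f : I -> A -> A -> A) :
  (forall i, P i -> bilinear (f i)) ->
  bilinear (fun x y => \sum_(i | P i) f i x y).
Proof.
move=> hf; split=> u k x y /=; rewrite scaler_sumr -big_split /=.
  by apply: eq_bigr => i /hf h; rewrite h.1.
by apply: eq_bigr => i /hf h; rewrite h.2.
Qed.

Lemma eq_totally_compatible dot op op' :
  op =2 op' -> totally_compatible dot op -> totally_compatible dot op'.
Proof.
move=> E [bil ass com]; split.
- split=> u k x y /=; rewrite -!E; first exact: bil.1.
  exact: bil.2.
- by move=> x y z; rewrite -!E.
- by move=> x y z; rewrite -!E.
Qed.

(** The identities to check equate products of three elements.  After expansion,
    a term in which [s] occurs is zero, and the others are all equal to [d] or
    all equal to [d ^+ 2] times a triple [dot]-product. *)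
Lemma null_perturbation_totally_compatible dot s d :
    bilinear dot -> associative dot -> bilinear s ->
    (forall x y z, s (s x y) z = 0) -> (forall x y z, s x (s y z) = 0) ->
    (forall x y z, s (dot x y) z = 0) -> (forall x y z, s x (dot y z) = 0) ->
    (forall x y z, dot (s x y) z = 0) -> (forall x y z, dot x (s y z) = 0) ->
  totally_compatible dot (fun x y => s x y + d *: dot x y).
Proof.
move=> bd ad bs ssl ssr sdl sdr dsl dsr.
pose dotDl := bilinear_Dl bd; pose dotDr := bilinear_Dr bd.
pose dotZl := bilinear_Zl bd; pose dotZr := bilinear_Zr bd.
pose sDl := bilinear_Dl bs; pose sDr := bilinear_Dr bs.
pose sZl := bilinear_Zl bs; pose sZr := bilinear_Zr bs.
split; first exact: (bilinear_add bs (bilinear_scale d bd)).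
  move=> x y z /=.
  rewrite !(dotDl, dotDr, dotZl, dotZr, sDl, sDr, sZl, sZr).
  by rewrite ssl ssr sdl sdr dsl dsr ad !(scaler0, add0r).
move=> x y z.
rewrite !(dotDl, dotDr, dotZl, dotZr, sDl, sDr, sZl, sZr).
by rewrite sdl sdr dsl dsr ad !add0r.
Qed.

End Bilinear.

(** * Matrix units in the strictly upper triangular algebra *)

Section MatrixUnits.
Variables (K : fieldType) (n : nat).
Local Notation UT := (UT K n).
Implicit Types (x y : UT) (i j k l p q r : 'I_n).

Lemma ut_mx_inj x y : ut_mx x = ut_mx y -> x = y.
Proof. exact: val_inj. Qed.

Lemma ut_P x y : (forall i j, ut_mx x i j = ut_mx y i j) -> x = y.
Proof. by move=> h; apply/ut_mx_inj/matrixP. Qed.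

Lemma ut_lower x i j : (j <= i)%N -> ut_mx x i j = 0.
Proof. exact: (sutP _ (valP x)). Qed.

Lemma ut_mxD x y : ut_mx (x + y) = ut_mx x + ut_mx y. Proof. by []. Qed.

Lemma ut_mxZ d x : ut_mx (d *: x) = d *: ut_mx x. Proof. by []. Qed.

Lemma ut_addE x y i j : ut_mx (x + y) i j = ut_mx x i j + ut_mx y i j.
Proof. by rewrite ut_mxD mxE. Qed.

Lemma ut_scaleE d x i j : ut_mx (d *: x) i j = d * ut_mx x i j.
Proof. by rewrite ut_mxZ mxE. Qed.

Lemma ut_0E i j : ut_mx (0 : UT) i j = 0.
Proof. by rewrite [ut_mx _](raddf0 (val : UT -> _)) mxE. Qed.

Lemma ut_basisE i j p q : (i < j)%N ->
  ut_mx (ut_e K n i j) p q = ((p == i) && (q == j))%:R.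
Proof. by move=> lt_ij; rewrite ut_eE // mxE. Qed.

Lemma ut_sum_basis x :
  x = \sum_(i < n) \sum_(j < n | (i < j)%N) ut_mx x i j *: ut_e K n i j.
Proof.
apply: val_inj => /=; rewrite [LHS]matrix_sum_delta.
rewrite [RHS](raddf_sum (val : UT -> _)); apply: eq_bigr => i _.
rewrite raddf_sum (bigID (fun j => (i < j)%N)) /= [X in _ + X]big1 ?addr0.
  by apply: eq_bigr => j lt_ij; rewrite -(ut_eE K lt_ij).
by move=> j; rewrite -leqNgt => /(ut_lower x) ->; rewrite scale0r.
Qed.

Lemma linear_ut_ext (f g : UT -> UT) :
    GRing.linear_for *:%R f -> GRing.linear_for *:%R g ->
    (forall i j, (i < j)%N -> f (ut_e K n i j) = g (ut_e K n i j)) ->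
  f =1 g.
Proof.
move=> lf lg h x.
pose F : {linear UT -> UT} :=
  HB.pack f (GRing.isLinear.Build K UT UT *:%R f lf).
pose G : {linear UT -> UT} :=
  HB.pack g (GRing.isLinear.Build K UT UT *:%R g lg).
rewrite -[f x]/(F x) -[g x]/(G x) (ut_sum_basis x) !linear_sum.
apply: eq_bigr => i _; rewrite !linear_sum; apply: eq_bigr => j lt_ij.
by rewrite !linearZ /= h.
Qed.

Lemma bilinear_ut_ext (f g : UT -> UT -> UT) :
    bilinear f -> bilinear g ->
    (forall i j k l, (i < j)%N -> (k < l)%N ->
       f (ut_e K n i j) (ut_e K n k l) = g (ut_e K n i j) (ut_e K n k l)) ->
  f =2 g.
Proof.
move=> bf bg h x y.
apply: (linear_ut_ext (f := f^~ y) (g := g^~ y)) => [|| i j lt_ij].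
- exact: bf.1.
- exact: bg.1.
- by apply: linear_ut_ext => [|| k l lt_kl];
    [exact: bf.2 | exact: bg.2 | exact: h].
Qed.

Lemma ut_mul_bilinear : bilinear (@ut_mul K n).
Proof.
split=> u c x y; apply: ut_mx_inj => /=.
  by rewrite mulmxDl -scalemxAl.
by rewrite mulmxDr -scalemxAr.
Qed.

(** Multiplication by matrix units reads off single rows and columns; this is
    how identities between products become statements on the entries of [op x y]. *)
Lemma ut_mul_el p r x i q : (p < r)%N ->
  ut_mx (ut_mul (ut_e K n p r) x) i q = if i == p then ut_mx x r q else 0.
Proof.
move=> lt_pr; rewrite /= ut_eE // mxE (bigD1 r) //= [X in _ + X]big1 ?addr0.
  by rewrite mxE eqxx andbT; case: eqP => _; rewrite (mul0r, mul1r).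
by move=> j /negPf ne_jr; rewrite mxE ne_jr andbF mul0r.
Qed.

Lemma ut_mul_er r p x i q : (r < p)%N ->
  ut_mx (ut_mul x (ut_e K n r p)) i q = if q == p then ut_mx x i r else 0.
Proof.
move=> lt_rp; rewrite /= ut_eE // mxE (bigD1 r) //= [X in _ + X]big1 ?addr0.
  by rewrite mxE eqxx; case: eqP => _; rewrite (mulr0, mulr1).
by move=> j /negPf ne_jr; rewrite mxE ne_jr mulr0.
Qed.

Lemma ut_mul_basis i j k l : (i < j)%N -> (k < l)%N ->
  ut_mul (ut_e K n i j) (ut_e K n k l) = if j == k then ut_e K n i l else 0.
Proof.
move=> lt_ij lt_kl; apply: ut_P => p q; rewrite ut_mul_el //.
rewrite ut_basisE //; case: (eqVneq j k) => [eq_jk|_] /=; last first.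
  by rewrite ut_0E if_same.
have lt_il : (i < l)%N by apply: ltn_trans lt_ij _; rewrite eq_jk.
by rewrite ut_basisE //; case: eqP.
Qed.

Lemma ut_mul_superdiag x y p q : q = p.+1 :> nat -> ut_mx (ut_mul x y) p q = 0.
Proof.
move=> eq_qp; rewrite /= mxE big1 // => k _.
have [le_kp|lt_pk] := leqP k p; first by rewrite ut_lower ?mul0r.
by rewrite [X in _ * X]ut_lower ?mulr0 // eq_qp.
Qed.

Lemma product_of_table_bilinear t : bilinear (@product_of_table K n t).
Proof.
apply: bilinear_sum => i _; apply: bilinear_sum => j _.
apply: bilinear_sum => k _; apply: bilinear_sum => l _.
split=> u c x y /=; rewrite !mxE scalerA -scalerDl.
  by rewrite mulrDl mulrA.
by rewrite mulrDr mulrCA.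
Qed.

Lemma T2E : @T2 K n =2 @ut_mul K n.
Proof.
apply: bilinear_ut_ext => [|| i j k l lt_ij lt_kl].
- exact: product_of_table_bilinear.
- exact: ut_mul_bilinear.
- by rewrite /T2 product_of_table_e // ut_mul_basis.
Qed.

End MatrixUnits.

(** * Combinations of corner-valued products *)

Section CornerProducts.
Variables (K : fieldType) (n : nat).
Local Notation UT := (UT K n).
Implicit Types (c : 'I_n -> 'I_n -> K) (x y z : UT).

Lemma T1_combination_bilinear c : bilinear (T1_combination c).
Proof.
apply: bilinear_sum => i _; apply: bilinear_sum => j _.
exact/bilinear_scale/product_of_table_bilinear.
Qed.

Lemma T1_combination_basis c (i j k l : 'I_n) : (i < j)%N -> (k < l)%N ->
  T1_combination c (ut_e K n i j) (ut_e K n k l) =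
  if (j == i.+1 :> nat) && (l == k.+1 :> nat)
  then c j k *: ut_e K n 0 n.-1 else 0.
Proof.
move=> lt_ij lt_kl; rewrite /T1_combination.
have j_gt0 : (0 < j)%N by apply: leq_ltn_trans lt_ij.
have k_lt : (k < n.-1)%N.
  rewrite -ltnS prednK ?(leq_ltn_trans lt_kl) //.
  exact: leq_ltn_trans (ltn_ord l).
rewrite (bigD1 j) //= [X in _ + X]big1 ?addr0; last first.
  move=> p /andP[_ ne_pj]; rewrite big1 // => q _.
  rewrite /T1 product_of_table_e // [j == p :> nat]eq_sym.
  by rewrite (negPf ne_pj : (p == j :> nat) = false) andbF scaler0.
rewrite (bigD1 k) //= [X in _ + X]big1 ?addr0; last first.
  move=> q /andP[_ ne_qk].
  rewrite /T1 product_of_table_e // [k == q :> nat]eq_sym.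
  by rewrite (negPf ne_qk : (q == k :> nat) = false) !andbF scaler0.
rewrite /T1 product_of_table_e // !eqxx /=.
have -> : (i == j.-1 :> nat) = (j == i.+1 :> nat).
  by rewrite -[in RHS](prednK j_gt0) eqSS eq_sym.
by case: ifP => // _; rewrite scaler0.
Qed.

(** Only the superdiagonals of the arguments enter the table of [T1 i j]. *)
Lemma T1_combination_null_l c x y :
    (forall p q : 'I_n, q = p.+1 :> nat -> ut_mx x p q = 0) ->
  T1_combination c x y = 0.
Proof.
move=> x0; rewrite /T1_combination big1 // => i i_gt0; rewrite big1 // => j _.
rewrite /T1 /product_of_table big1 ?scaler0 // => p _; rewrite big1 // => q _.
rewrite big1 // => r _; rewrite big1 // => s _.
case: ifP => [/and4P[/eqP eq_p /eqP eq_q _ _] | _]; last by rewrite scaler0.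
by rewrite x0 ?mul0r ?scale0r // eq_p prednK.
Qed.

Lemma T1_combination_null_r c x y :
    (forall p q : 'I_n, q = p.+1 :> nat -> ut_mx y p q = 0) ->
  T1_combination c x y = 0.
Proof.
move=> y0; rewrite /T1_combination big1 // => i i_gt0; rewrite big1 // => j _.
rewrite /T1 /product_of_table big1 ?scaler0 // => p _; rewrite big1 // => q _.
rewrite big1 // => r _; rewrite big1 // => s _.
case: ifP => [/and4P[_ _ /eqP eq_r /eqP eq_s] | _]; last by rewrite scaler0.
by rewrite y0 ?mulr0 ?scale0r // eq_r eq_s.
Qed.

Lemma T1_combination_corner c x y :
  exists d, T1_combination c x y = d *: ut_e K n 0 n.-1.
Proof.
pose on_corner z := exists d, z = d *: ut_e K n 0 n.-1.
have cornerD z z' : on_corner z -> on_corner z' -> on_corner (z + z').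
  by move=> [d ->] [d' ->]; exists (d + d'); rewrite scalerDl.
have cornerZ d z : on_corner z -> on_corner (d *: z).
  by move=> [d' ->]; exists (d * d'); rewrite scalerA.
have corner0 : on_corner 0 by exists 0; rewrite scale0r.
rewrite -/(on_corner _).
apply: big_ind => // i _; apply: big_ind => // j _; apply: (cornerZ).
apply: big_ind => // p _; apply: big_ind => // q _.
apply: big_ind => // r _; apply: big_ind => // s _; apply: (cornerZ).
by case: ifP => // _; exists 1; rewrite scale1r.
Qed.

Hypothesis n_ge3 : (2 < n)%N.

Let n_gt0 : (0 < n)%N. Proof. exact: leq_trans n_ge3. Qed.
Let bot := Ordinal n_gt0.
Let lt_top : (n.-1 < n)%N. Proof. by rewrite prednK. Qed.
Let top := Ordinal lt_top.

Let lt_bot_top : (bot < top)%N.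
Proof. by rewrite /= -ltnS prednK // ltnW. Qed.

Lemma ut_mul_corner_l x : ut_mul (ut_e K n 0 n.-1) x = 0.
Proof.
apply: ut_P => p q; rewrite (ut_mul_el (p := bot) (r := top)) //.
by rewrite ut_0E ut_lower ?if_same //= -ltnS prednK.
Qed.

Lemma ut_mul_corner_r x : ut_mul x (ut_e K n 0 n.-1) = 0.
Proof.
apply: ut_P => p q; rewrite (ut_mul_er (r := bot) (p := top)) //.
by rewrite ut_0E ut_lower ?if_same.
Qed.

Lemma corner_superdiag (p q : 'I_n) :
  q = p.+1 :> nat -> ut_mx (ut_e K n 0 n.-1) p q = 0.
Proof.
move=> eq_qp; rewrite (ut_basisE K (i := bot) (j := top)) //.
case: eqP => // eq_p; case: eqP => // eq_q.
move: n_ge3; rewrite -(prednK n_gt0) ltnS -[n.-1]/(top : nat) -eq_q eq_qp.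
by rewrite eq_p.
Qed.

Lemma T1_plus_mul_totally_compatible c d :
  totally_compatible (@ut_mul K n)
    (fun x y => T1_combination c x y + d *: ut_mul x y).
Proof.
have superdiag_T1 x y (p q : 'I_n) : q = p.+1 :> nat ->
    ut_mx (T1_combination c x y) p q = 0.
  move=> eq_qp; have [e ->] := T1_combination_corner c x y.
  by rewrite ut_scaleE corner_superdiag ?mulr0.
apply: null_perturbation_totally_compatible.
- exact: ut_mul_bilinear.
- exact: ut_mulA.
- exact: T1_combination_bilinear.
- by move=> x y z; apply: T1_combination_null_l => p q; apply: superdiag_T1.
- by move=> x y z; apply: T1_combination_null_r => p q; apply: superdiag_T1.
- by move=> x y z; apply: T1_combination_null_l => p q; apply: ut_mul_superdiag.
- by move=> x y z; apply: T1_combination_null_r => p q; apply: ut_mul_superdiag.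
- move=> x y z; have [e ->] := T1_combination_corner c x y.
  by rewrite (bilinear_Zl (ut_mul_bilinear K n)) ut_mul_corner_l scaler0.
- move=> x y z; have [e ->] := T1_combination_corner c y z.
  by rewrite (bilinear_Zr (ut_mul_bilinear K n)) ut_mul_corner_r scaler0.
Qed.

(** * The matrix entries of a totally compatible product *)

Section Classification.
Variable op : UT -> UT -> UT.
Hypothesis op_tc : totally_compatible (@ut_mul K n) op.

Local Notation e := (ut_e K n).
Implicit Types (i j k l p q r : 'I_n).

Let op_bil : bilinear op. Proof. by case: op_tc. Qed.

Let op_mull x y z : op (ut_mul x y) z = ut_mul x (op y z).
Proof. by case: op_tc => _ _ h; case: (h x y z) => -> ->. Qed.

Let op_mulr x y z : op x (ut_mul y z) = ut_mul (op x y) z.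
Proof. by case: op_tc => _ _ h; case: (h x y z) => _ -> ->. Qed.

Let op_mulm x y z : ut_mul (op x y) z = ut_mul x (op y z).
Proof. by case: op_tc => _ _ h; case: (h x y z). Qed.

Let ltn0_bot p : p != bot -> (bot < p)%N.
Proof. by rewrite lt0n. Qed.

Let ltn_top q : q != top -> (q < top)%N.
Proof.
by move=> ne; rewrite ltn_neqAle -ltnS /= prednK // ltn_ord andbT.
Qed.

Let op_entry_l x y p q : p != bot ->
  ut_mx (op x y) p q = ut_mx (op (ut_mul (e bot p) x) y) bot q.
Proof. by move=> /ltn0_bot lt_p; rewrite op_mull ut_mul_el // eqxx. Qed.

Let op_entry_r x y p q : q != top ->
  ut_mx (op x y) p q = ut_mx (op x (ut_mul y (e q top))) p top.
Proof. by move=> /ltn_top lt_q; rewrite op_mulr ut_mul_er // eqxx. Qed.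

(** Outside the corner, an entry can be moved to row [bot] by a matrix unit on
    the left, or to column [top] by one on the right.  The condition [j = k]
    then comes from [a(b*c) = a*(bc)] and [(a*b)c = (ab)*c], the condition
    [p = i] from [a(b*c) = (ab)*c] or [(a*b)c = a(b*c)], and the condition
    [q = l] from the mirror images of the latter. *)
Let op_entry_eq0 i j k l p q : (i < j)%N -> (k < l)%N ->
  (p != bot) || (q != top) -> ~~ [&& j == k, p == i & q == l] ->
  ut_mx (op (e i j) (e k l)) p q = 0.
Proof.
move=> lt_ij lt_kl off; rewrite !negb_and => /or3P[ne_jk|ne_pi|ne_ql].
- have e0 : ut_mul (e i j) (e k l) = 0 by rewrite ut_mul_basis // (negPf ne_jk).
  case/orP: off => [/ltn0_bot lt_p|/ltn_top lt_q].
    have -> : ut_mx (op (e i j) (e k l)) p q =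
              ut_mx (ut_mul (e bot p) (op (e i j) (e k l))) bot q.
      by rewrite ut_mul_el // eqxx.
    by rewrite -op_mulm -op_mulr e0 (bilinear_0r op_bil) ut_0E.
  have -> : ut_mx (op (e i j) (e k l)) p q =
            ut_mx (ut_mul (op (e i j) (e k l)) (e q top)) p top.
    by rewrite ut_mul_er // eqxx.
  by rewrite op_mulm -op_mull e0 (bilinear_0l op_bil) ut_0E.
- have [eq_p|ne_p] := eqVneq p bot; last first.
    rewrite op_entry_l // ut_mul_basis ?ltn0_bot // (negPf ne_pi).
    by rewrite (bilinear_0l op_bil) ut_0E.
  move: off; rewrite eq_p eqxx /= => ne_q; rewrite op_entry_r //.
  by rewrite op_mulr op_mulm ut_mul_el // -eq_p (negPf ne_pi).
- have [eq_q|ne_q] := eqVneq q top; last first.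
    rewrite op_entry_r // ut_mul_basis ?ltn_top // eq_sym (negPf ne_ql).
    by rewrite (bilinear_0r op_bil) ut_0E.
  move: off; rewrite eq_q eqxx orbF => ne_p; rewrite op_entry_l //.
  by rewrite op_mull -op_mulm ut_mul_er // -eq_q (negPf ne_ql).
Qed.

(** The common coefficient at [(i, l)] of all [op (e i j) (e j l)], read in the
    case where [(i, l)] is the corner. *)
Let weight j := ut_mx (op (e bot j) (e j top)) bot top.

Let op_entry_weight i j l : (i < j)%N -> (j < l)%N ->
  ut_mx (op (e i j) (e j l)) i l = weight j.
Proof.
move=> lt_ij lt_jl.
have -> : ut_mx (op (e i j) (e j l)) i l = ut_mx (op (e bot j) (e j l)) bot l.
  have [->//|ne_i] := eqVneq i bot.
  by rewrite op_entry_l // ut_mul_basis ?eqxx ?ltn0_bot.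
have [->//|ne_l] := eqVneq l top.
by rewrite op_entry_r // ut_mul_basis ?eqxx ?ltn_top.
Qed.

Let weight_const j l : (bot < j)%N -> (j < l)%N -> (l < top)%N ->
  weight j = weight l.
Proof.
move=> j_gt0 lt_jl lt_l.
rewrite -(op_entry_weight j_gt0 lt_jl) -(op_entry_weight lt_jl lt_l).
have := congr1 (fun z : UT => ut_mx z bot top)
               (op_mulm (e bot j) (e j l) (e l top)).
by rewrite ut_mul_el // ut_mul_er // !eqxx.
Qed.

Let lt_1n : (1 < n)%N. Proof. exact: ltnW. Qed.
Let one := Ordinal lt_1n.
Let d := weight one.

Let weightE j : (bot < j)%N -> (j < top)%N -> weight j = d.
Proof.
move=> j_gt0 lt_j; have [eq_j|ne_j] := eqVneq j one; first by rewrite eq_j.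
by rewrite /d (weight_const (j := one) (l := j)) // ltn_neqAle eq_sym ne_j.
Qed.

Let op_entry i j k l p q : (i < j)%N -> (k < l)%N ->
  (p != bot) || (q != top) ->
  ut_mx (op (e i j) (e k l)) p q = d * ut_mx (ut_mul (e i j) (e k l)) p q.
Proof.
move=> lt_ij lt_kl off.
rewrite ut_mul_basis //.
have [/and3P[/eqP eq_jk /eqP-> /eqP->]|nz] :=
  boolP [&& j == k, p == i & q == l].
  rewrite -eq_jk eqxx in lt_kl *.
  rewrite op_entry_weight // weightE ?ut_basisE ?(ltn_trans lt_ij) //.
  - by rewrite !eqxx mulr1.
  - exact: leq_ltn_trans (leq0n i) lt_ij.
  - by apply: leq_trans lt_kl _; rewrite /= -ltnS prednK.
rewrite op_entry_eq0 //; case: (eqVneq j k) nz => [eq_jk|_] /= nz; last first.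
  by rewrite ut_0E mulr0.
have lt_il : (i < l)%N by apply: ltn_trans lt_ij _; rewrite eq_jk.
by rewrite ut_basisE // (negPf nz) mulr0.
Qed.

(** With [e i j] factored through [i.+1], the identity [(ab)*c = a(b*c)] turns
    the corner entry into an entry of row [i.+1], which is not row [bot]. *)
Let op_corner_l i j k l : (i < j)%N -> (k < l)%N -> j != i.+1 :> nat ->
  ut_mx (op (e i j) (e k l)) bot top =
  d * ut_mx (ut_mul (e i j) (e k l)) bot top.
Proof.
move=> lt_ij lt_kl ne_j.
have lt_i1n : (i.+1 < n)%N by apply: leq_ltn_trans (ltn_ord j).
pose i1 := Ordinal lt_i1n.
have lt_ii1 : (i < i1)%N by [].
have lt_i1j : (i1 < j)%N by rewrite ltn_neqAle eq_sym ne_j.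
have -> : e i j = ut_mul (e i i1) (e i1 j) by rewrite ut_mul_basis ?eqxx.
rewrite op_mull -ut_mulA !ut_mul_el //; case: eqP => _; last by rewrite mulr0.
by rewrite op_entry // ut_mul_el.
Qed.

Let op_corner_r i j k l : (i < j)%N -> (k < l)%N -> l != k.+1 :> nat ->
  ut_mx (op (e i j) (e k l)) bot top =
  d * ut_mx (ut_mul (e i j) (e k l)) bot top.
Proof.
move=> lt_ij lt_kl ne_l.
have lt_k1n : (k.+1 < n)%N by apply: leq_ltn_trans (ltn_ord l).
pose k1 := Ordinal lt_k1n.
have lt_kk1 : (k < k1)%N by [].
have lt_k1l : (k1 < l)%N by rewrite ltn_neqAle eq_sym ne_l.
have -> : e k l = ut_mul (e k k1) (e k1 l) by rewrite ut_mul_basis ?eqxx.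
rewrite op_mulr ut_mulA !ut_mul_er //.
case: eqP => [eq_l|_]; last by rewrite mulr0.
rewrite op_entry ?ut_mul_er // -[k1 != top]/(k1 != n.-1 :> nat) orbC.
by rewrite -[n.-1]/(top : nat) eq_l neq_ltn lt_k1l.
Qed.

Lemma totally_compatible_T1_plus_mul :
  exists (c : 'I_n -> 'I_n -> K) (d : K),
    forall x y, op x y = T1_combination c x y + d *: ut_mul x y.
Proof.
(* Subtracting [d] times the matrix product matters at the corner only for
   [n = 3], where the product of two simple matrix units can be the corner. *)
pose c j k := ut_mx (op (e j.-1 j) (e k k.+1)) bot top
              - d * ut_mx (ut_mul (e j.-1 j) (e k k.+1)) bot top.
exists c, d; apply: bilinear_ut_ext => //.
  apply: (bilinear_add (T1_combination_bilinear c)).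
  exact/bilinear_scale/ut_mul_bilinear.
move=> i j k l lt_ij lt_kl; apply: ut_P => p q.
rewrite T1_combination_basis // ut_addE ut_scaleE.
have [off|] := boolP ((p != bot) || (q != top)).
  rewrite op_entry //; case: ifP => _; last by rewrite ut_0E add0r.
  rewrite ut_scaleE (ut_basisE K (i := bot) (j := top)) //.
  by move: off; rewrite -negb_and => /negPf->; rewrite mulr0 add0r.
rewrite negb_or !negbK => /andP[/eqP-> /eqP->].
case: (eqVneq (j : nat) i.+1) => [eq_j|ne_j]; last first.
  by rewrite ut_0E add0r op_corner_l.
case: (eqVneq (l : nat) k.+1) => [eq_l|ne_l]; last first.
  by rewrite ut_0E add0r op_corner_r.
rewrite ut_scaleE (ut_basisE K (i := bot) (j := top)) // !eqxx mulr1 /c.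
by rewrite eq_j eq_l /= subrK.
Qed.

End Classification.
End CornerProducts.

(** * The classification *)

Lemma totally_compatible_ut_mulP (K : fieldType) (n : nat)
    (op : UT K n -> UT K n -> UT K n) : (2 < n)%N ->
  totally_compatible (@ut_mul K n) op <->
  exists (c : 'I_n -> 'I_n -> K) (d : K),
    forall x y, op x y = T1_combination c x y + d *: ut_mul x y.
Proof.
move=> n_ge3; split; first exact: totally_compatible_T1_plus_mul.
move=> [c [d op_eq]].
apply: (eq_totally_compatible (fun x y => esym (op_eq x y))).
exact: T1_plus_mul_totally_compatible.
Qed.

Lemma T1_combination_add (K : fieldType) n (c c' : 'I_n -> 'I_n -> K) d x y :
  T1_combination (fun i j => c i j + d * c' i j) x y =
  T1_combination c x y + d *: T1_combination c' x y.
Proof.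
rewrite /T1_combination scaler_sumr -big_split /=; apply: eq_bigr => i _.
rewrite scaler_sumr -big_split /=; apply: eq_bigr => j _.
by rewrite scalerDl scalerA.
Qed.

Lemma ut_mul3_T1 (K : fieldType) (x y : UT K 3) :
  ut_mul x y = T1_combination (fun i j => (i == j)%:R) x y.
Proof.
move: x y; apply: bilinear_ut_ext => [|| i j k l lt_ij lt_kl].
- exact: ut_mul_bilinear.
- exact: T1_combination_bilinear.
rewrite ut_mul_basis // T1_combination_basis //.
have [eq_jk|ne_jk] := eqVneq j k; last by rewrite scale0r if_same.
have [-> -> -> ->] : [/\ i = 0%N :> nat, j = 1%N :> nat,
                         k = 1%N :> nat & l = 2%N :> nat].
  subst k; move: lt_ij lt_kl.
  by case: i j l => [[|[|[|?]]] ?] [[|[|[|?]]] ?] [[|[|[|?]]] ?].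
by rewrite scale1r.
Qed.

Theorem theorem5p1 (K : fieldType) (n : nat) (hn : (3 <= n)%N) :
  ((3 < n)%N ->
     forall op : UT K n -> UT K n -> UT K n,
       totally_compatible (@ut_mul K n) op <->
       exists (c : 'I_n -> 'I_n -> K) (d : K),
         forall a b : UT K n, op a b = T1_combination c a b + d *: T2 a b) /\
  (n = 3%N ->
     forall op : UT K n -> UT K n -> UT K n,
       totally_compatible (@ut_mul K n) op <->
       exists c : 'I_n -> 'I_n -> K,
         forall a b : UT K n, op a b = T1_combination c a b).
Proof.
split=> [_ op | n3 op].
  apply: (iff_trans (totally_compatible_ut_mulP op hn)).
  by split=> -[c [d h]]; exists c, d => x y; rewrite h T2E.
apply: (iff_trans (totally_compatible_ut_mulP op hn)); subst n.
split=> [[c [d h]] | [c h]].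
  (* The indices [i = j] allowed in the sum reduce to [i = j = 1]. *)
  exists (fun i j => c i j + d * (i == j)%:R) => x y.
  by rewrite h T1_combination_add ut_mul3_T1.
by exists c, 0 => x y; rewrite h scale0r addr0.
Qed.
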